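(* Let $A,B,C$ be completely distributive lattices. For order-preserving maps $f\colon A\to B$ and $g\colon B\to C$ define $g\cdot f\colon A\to C$ by $(g\cdot f)(a)=\bigvee\{c\in C\mid \exists b\in B:\ b\triangleleft f(a)\text{ and } c\triangleleft g(b)\}$. (1) If $f\colon A\to B$ is sup-preserving and $g\colon B\to C$ is order-preserving, then $g\cdot f$ is sup-preserving. (2) If $f\colon A\to B$ and $g\colon B\to C$ are both sup-preserving, then $g\cdot f=g\circ f$, where $\circ$ is the usual composition of maps.
   Context: In a complete lattice $P$, $x\triangleleft y$ ($x$ is wedge-below $y$) means that for every subset $S\subseteq P$ (possibly empty) with $y\leq\bigvee S$ there is $s\in S$ with $x\leq s$. A complete lattice $L$ is completely distributive if $x=\bigvee\{y\in L\mid y\triangleleft x\}$ for all $x\in L$. A map is sup-preserving if it preserves arbitrary suprema (including the empty one). *)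

(* Defs.v *)
From HB Require Import structures.
From mathcomp Require Import all_boot all_order boolp classical_sets.

Set Implicit Arguments.
Unset Strict Implicit.
Unset Printing Implicit Defensive.

Import Order.TTheory.

Local Open Scope classical_set_scope.
Local Open Scope order_scope.

(* [glb] is determined by [lub]; both are kept so that the structure reads as
   the usual definition of a complete lattice. The sets may be empty. *)
HB.mixin Record TBLattice_isComplete (d : Order.disp_t) T
    of Order.TBLattice d T := {
  lub : set T -> T;
  glb : set T -> T;
  lub_subproof : forall S, isLub S (lub S);
  glb_subproof : forall S,
    lbound S (glb S) /\ (forall b, lbound S b -> b <= glb S)
}.

#[short(type="completeLatticeType")]
HB.structure Definition CompleteLattice (d : Order.disp_t) :=
  { T of TBLattice_isComplete d T & Order.TBLattice d T }.

Section CompleteLatticeTheory.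
Variables (d : Order.disp_t) (L : completeLatticeType d).

Lemma lub_isLub (S : set L) : isLub S (lub S).
Proof. exact: lub_subproof. Qed.

Lemma le_lub (S : set L) (x : L) : S x -> x <= lub S.
Proof. by case: (lub_isLub S) => + _; apply. Qed.

Lemma lub_le (S : set L) (y : L) : (forall x, S x -> x <= y) -> lub S <= y.
Proof. by case: (lub_isLub S) => _; apply. Qed.

Definition wedge_below (x y : L) : Prop :=
  forall S : set L, y <= lub S -> exists2 s, S s & x <= s.

End CompleteLatticeTheory.

Definition completely_distributive (d : Order.disp_t)
    (L : completeLatticeType d) : Prop :=
  forall x : L, x = lub [set y : L | wedge_below y x].

Definition sup_preserving (dA dB : Order.disp_t) (A : completeLatticeType dA)
    (B : completeLatticeType dB) (f : A -> B) : Prop :=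
  forall S : set A, f (lub S) = lub (f @` S).

(* The operation g . f, here defined for arbitrary maps. *)
Definition wedge_comp (dA dB dC : Order.disp_t) (A : completeLatticeType dA)
    (B : completeLatticeType dB) (C : completeLatticeType dC)
    (g : B -> C) (f : A -> B) : A -> C :=
  fun a => lub [set c : C |
    exists b : B, wedge_below b (f a) /\ wedge_below c (g b)].

(* Main.v *)
(** If [b] is wedge-below [f (lub S) = lub (f @` S)], interpolating some [b']
    between them gives [b' <= f s] for an [s] in [S], so that [b] is
    still wedge-below [f s]; this is (1). For (2), complete distributivity of [C]
    turns [g . f] into the supremum of the [g b] over all [b] wedge-below [f a],
    which is [g (f a)] as [g] preserves the supremum [f a] of these [b]. *)
Require Import Defs.
From mathcomp Require Import all_boot all_order boolp classical_sets.

Set Implicit Arguments.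
Unset Strict Implicit.
Unset Printing Implicit Defensive.

Import Order.TTheory.

Local Open Scope classical_set_scope.
Local Open Scope order_scope.

Section WedgeBelow.
Variables (d : Order.disp_t) (L : completeLatticeType d).
Implicit Types x y z : L.

Lemma wedge_below_le_trans x y z :
  wedge_below x y -> y <= z -> wedge_below x z.
Proof. by move=> xy yz S zS; apply: xy; apply: le_trans zS. Qed.

Lemma le_wedge_below_trans x y z :
  x <= y -> wedge_below y z -> wedge_below x z.
Proof.
by move=> xy yz S /yz[s Ss ys]; exists s => //; apply: le_trans ys.
Qed.

Hypothesis cdL : completely_distributive L.

(** Applying complete distributivity twice, to [y] and then to each [z] wedge-below [y], bounds [y]
    by the supremum of those [w] that lie two wedge-below steps under it. Hence [x] is below one
    such [w], whose intermediate element interpolates. *)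
Lemma wedge_below_interpolation x y :
  wedge_below x y -> exists2 z, wedge_below x z & wedge_below z y.
Proof.
move=> xy.
have /xy[w [z wz zy] xw] :
    y <= lub [set w | exists2 z, wedge_below w z & wedge_below z y].
  rewrite {1}(cdL y); apply: lub_le => z zy.
  by rewrite {1}(cdL z); apply: lub_le => w wz; apply: le_lub; exists z.
by exists z => //; apply: le_wedge_below_trans wz.
Qed.

End WedgeBelow.

(** If [x <= y], then [y] is the supremum of the pair, so [f y] is the supremum of an image
    containing [f x]. *)
Lemma sup_preserving_homo (dA dB : Order.disp_t) (A : completeLatticeType dA)
    (B : completeLatticeType dB) (f : A -> B) :
  sup_preserving f -> {homo f : x y / x <= y}.
Proof.
move=> fsup x y xy.
have -> : y = lub [set x; y].
  apply/le_anti/andP; split; first by apply: le_lub; right.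
  by apply: lub_le => _ [->|->].
by rewrite fsup; apply: le_lub; exists x => //; left.
Qed.

Section WedgeComp.
Variables (dA dB dC : Order.disp_t) (A : completeLatticeType dA).
Variables (B : completeLatticeType dB) (C : completeLatticeType dC).
Variables (f : A -> B) (g : B -> C).

Lemma wedge_comp_sup_preserving :
  completely_distributive B -> sup_preserving f ->
  sup_preserving (wedge_comp g f).
Proof.
move=> cdB fsup S; apply/le_anti/andP; split.
  (* Testing [b] itself against the image of [S] would only yield [b <= f s]; the interpolant [b']
     keeps the relation to [f s] strong enough. *)
  apply: lub_le => c [b [/(wedge_below_interpolation cdB)[b' bb' b'S] cgb]].
  have [_ [s Ss <-] b's] : exists2 y, (f @` S) y & b' <= y.
    by apply: b'S; rewrite fsup.
  apply: (@le_trans _ _ (wedge_comp g f s)); last by apply: le_lub; exists s.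
  by apply: le_lub; exists b; split=> //; apply: wedge_below_le_trans b's.
apply: lub_le => _ [s Ss <-]; apply: lub_le => c [b [bfs cgb]].
apply: le_lub; exists b; split=> //; apply: wedge_below_le_trans bfs _.
by apply: sup_preserving_homo => //; apply: le_lub.
Qed.

(** The supremum over pairs of [b] and [c] can be taken over [c] first: for fixed [b], the [c]
    wedge-below [g b] join to [g b]. *)
Lemma wedge_compE (a : A) : completely_distributive C ->
  wedge_comp g f a = lub (g @` [set b | wedge_below b (f a)]).
Proof.
move=> cdC; apply/le_anti/andP; split; apply: lub_le.
  move=> c [b [bfa cgb]].
  apply: (@le_trans _ _ (g b)); last by apply: le_lub; exists b.
  by rewrite (cdC (g b)); apply: le_lub.
move=> _ [b bfa <-]; rewrite (cdC (g b)).
by apply: lub_le => c cgb; apply: le_lub; exists b.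
Qed.

End WedgeComp.

Theorem proposition3p6 (dA dB dC : Order.disp_t)
    (A : completeLatticeType dA) (B : completeLatticeType dB)
    (C : completeLatticeType dC)
    (cdA : completely_distributive A) (cdB : completely_distributive B)
    (cdC : completely_distributive C) :
  (forall (f : A -> B) (g : B -> C),
     sup_preserving f -> {homo g : x y / (x <= y)%O} ->
     sup_preserving (wedge_comp g f)) /\
  (forall (f : A -> B) (g : B -> C),
     sup_preserving f -> sup_preserving g ->
     wedge_comp g f = g \o f).
Proof.
split=> [f g fsup _|f g _ gsup]; first exact: wedge_comp_sup_preserving.
by apply/funext => a; rewrite wedge_compE // -gsup -cdB.
Qed.
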